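(* Let $E$ be a set and let $L$ be a sublattice of the lattice of equivalence relations on $E$ which contains the equality relation and is closed under arbitrary intersections. For $x,y\in E$ let $d(x,y)$ be the least member of $L$ containing the pair $(x,y)$, and let $\mathbf{E}:=(E,d)$, a generalized ultrametric space over $L$. Then $L$ is arithmetical if and only if $\mathbf{E}$ is finitely hyperconvex.
   Context: The set of equivalence relations on $E$ is a lattice under inclusion; its least element $0$ is the equality relation. Arbitrary intersections include the empty one, so that $E\times E\in L$ and $d$ is well defined. A sublattice $L$ of this lattice is arithmetical if it is distributive and any two members commute under composition: $\rho\circ\theta=\theta\circ\rho$ for all $\rho,\theta\in L$. Here $L$ is ordered by inclusion, with join $\vee$. For $a\in E$ and $r\in L$, the closed ball is $B(a,r):=\{x\in E: d(a,x)\leq r\}$. The space $\mathbf{E}$ is finitely hyperconvex if for every finite family of closed balls $(B(a_i,r_i))_{i\in I}$ with $a_i\in E$, $r_i\in L$, such that $d(a_i,a_j)\leq r_i\vee r_j$ for all $i,j\in I$, the intersection $\bigcap_{i\in I}B(a_i,r_i)$ is non-empty. *)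

(* Defs.v *)
From mathcomp Require Import all_boot.
From mathcomp Require Export mathcomp_extra boolp classical_sets.

Set Implicit Arguments.
Unset Strict Implicit.
Unset Printing Implicit Defensive.

Local Open Scope classical_set_scope.
Local Open Scope relation_scope.

(* Binary relations on E are subsets of E * E, ordered by inclusion. *)

Definition is_equivalence {E : Type} (r : set (E * E)) : Prop :=
  [/\ forall x, r (x, x),
      forall x y, r (x, y) -> r (y, x)
    & forall x y z, r (x, y) -> r (y, z) -> r (x, z)].

(* The join in the lattice of all equivalence relations on E; the meet is the
   intersection. *)
Definition eqv_join {E : Type} (r s : set (E * E)) : set (E * E) :=
  smallest is_equivalence (r `|` s).

Definition eqv_sublattice {E : Type} (L : set (set (E * E))) : Prop :=
  [/\ forall r, L r -> is_equivalence r,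
      forall r s, L r -> L s -> L (r `&` s)
    & forall r s, L r -> L s -> L (eqv_join r s)].

(* S may be empty, in which case the intersection is setT. *)
Definition bigcap_closed {T : Type} (L : set (set T)) : Prop :=
  forall S : set (set T), S `<=` L -> L (\bigcap_(r in S) r).

Definition distributive_lattice {E : Type} (L : set (set (E * E))) : Prop :=
  forall r s t, L r -> L s -> L t ->
    r `&` eqv_join s t = eqv_join (r `&` s) (r `&` t).

Definition arithmetical {E : Type} (L : set (set (E * E))) : Prop :=
  distributive_lattice L /\
  forall r s, L r -> L s -> r \; s = s \; r.

(* [smallest] is an intersection; [dist_least] shows that it is a least member
   of L. *)
Definition dist {E : Type} (L : set (set (E * E))) (x y : E) : set (E * E) :=
  smallest L [set (x, y)].

Definition cball {E : Type} (d : E -> E -> set (E * E)) (a : E)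
    (r : set (E * E)) : set E :=
  [set x | d a x `<=` r].

(* Families are indexed by nonempty types: the intersection of the empty family
   is E itself, so this only matters when E is empty. *)
Definition finitely_hyperconvex {E : Type} (L : set (set (E * E)))
    (d : E -> E -> set (E * E)) : Prop :=
  forall (I : finType) (a : I -> E) (r : I -> set (E * E)),
    (0 < #|I|)%N ->
    (forall i, L (r i)) ->
    (forall i j, d (a i) (a j) `<=` eqv_join (r i) (r j)) ->
    \bigcap_(i in [set: I]) cball d (a i) (r i) !=set0.

Lemma dist_least {E : Type} (L : set (set (E * E))) (x y : E) :
  bigcap_closed L ->
  [/\ L (dist L x y), dist L x y (x, y)
    & forall r, L r -> r (x, y) -> dist L x y `<=` r].
Proof.
move=> Lcap; split; first by apply: Lcap => r [].
- by move=> r [_]; apply.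
- by move=> r Lr rxy; apply: smallest_sub => // _ ->.
Qed.

Lemma dist_generalized_ultrametric {E : Type} (L : set (set (E * E))) :
  eqv_sublattice L -> L diagonal -> bigcap_closed L ->
  [/\ forall x y, dist L x y = diagonal <-> x = y,
      forall x y, dist L x y = dist L y x
    & forall x y z, dist L x z `<=` eqv_join (dist L x y) (dist L y z)].
Proof.
move=> [Leqv _ Ljoin] L0 Lcap.
have dL x y : L (dist L x y) by have [] := dist_least x y Lcap.
have dxy x y : dist L x y (x, y) by have [] := dist_least x y Lcap.
have dle r x y : L r -> r (x, y) -> dist L x y `<=` r.
  by have [_ _] := dist_least x y Lcap; apply.
have drefl x y z : dist L x y (z, z) by have [+ _ _] := Leqv _ (dL x y); apply.
have dsym x y : dist L x y (y, x).
  by have [_ + _] := Leqv _ (dL x y); apply; exact: dxy.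
split=> [x y|x y|x y z].
- split=> [dE|<-]; first by have := dxy x y; rewrite dE.
  apply/seteqP; split; first exact: dle.
  by move=> [u v] /diagonalP ->.
- by apply/seteqP; split; apply: dle.
- apply: dle; first exact: Ljoin.
  move=> r [[_ _ rtrans] rsub]; apply: (rtrans _ y).
  + by apply: rsub; left.
  + by apply: rsub; right.
Qed.

(* Main.v *)
(** A ball [cball (dist L) a r] with [r] in [L] is the [r]-class of [a], so finite
    hyperconvexity says that a finite system of congruences [x = a_i mod r_i] is
    solvable as soon as [(a_i, a_j)] lies in the join of [r_i] and [r_j]: it is the
    Chinese remainder property. If [L] is arithmetical, joins are relational
    products, and distributivity lets one replace the congruences solved so far by
    the single one modulo the intersection of their [r_i], hence an induction.
    Conversely, a common point [w] of the balls B(x, s), B(y, t) and B(x, r), where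
    [(x, y)] lies in [r] and in the join of [s] and [t], shows that [(x, y)] is in
    the product of [r `&` s] and [r `&` t], whence distributivity; two balls
    suffice for commutation. *)
Require Import Defs.
From mathcomp Require Import all_boot.
From mathcomp Require Import mathcomp_extra boolp classical_sets.

Set Implicit Arguments.
Unset Strict Implicit.
Unset Printing Implicit Defensive.

Local Open Scope classical_set_scope.
Local Open Scope relation_scope.

Section EquivalenceJoin.
Variable E : Type.
Implicit Types r s t : set (E * E).

Lemma eqv_join_is_equivalence r s : is_equivalence (eqv_join r s).
Proof.
split=> [x|x y rsxy|x y z rsxy rsyz] q [qeqv qsub]; have [q1 q2 q3] := qeqv.
- exact: q1.
- by apply: q2; apply: rsxy.
- by apply: (q3 _ y); [apply: rsxy|apply: rsyz].
Qed.

Lemma eqv_joinl r s : r `<=` eqv_join r s.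
Proof. by move=> p rp q [_]; apply; left. Qed.

Lemma eqv_joinr r s : s `<=` eqv_join r s.
Proof. by move=> p sp q [_]; apply; right. Qed.

Lemma eqv_join_min r s t :
  is_equivalence t -> r `<=` t -> s `<=` t -> eqv_join r s `<=` t.
Proof. by move=> teqv rt st; apply: smallest_sub => // p [/rt|/st]. Qed.

Lemma eqv_joinC r s : eqv_join r s = eqv_join s r.
Proof. by rewrite /eqv_join setUC. Qed.

(* In classical_sets, [s \; r] relates [x] to [y] when [r (x, z)] and [s (z, y)]
   for some [z]. *)
Lemma eqv_join_comp r s : is_equivalence r -> is_equivalence s ->
  r \; s = s \; r -> eqv_join r s = s \; r.
Proof.
move=> [r1 r2 r3] [s1 s2 s3] rsC; apply/seteqP; split.
  apply: eqv_join_min => [|[x y] rxy|[x y] sxy]; last 2 first.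
  - by exists y.
  - by exists x.
  split=> [x|x y [z rxz szy]|x y z [u rxu suy] [v ryv svz]].
  - by exists x.
  - by rewrite -rsC; exists z; [exact: s2|exact: r2].
  (* Commutation swaps the middle factors: [x r u s y r v s z] becomes [x r u r w s v s z]. *)
  - have [w /= ruw swv] : (s \; r) (u, v) by rewrite -rsC; exists y.
    by exists w => /=; [apply: r3 ruw|apply: s3 svz].
have [_ _ jtrans] := eqv_join_is_equivalence r s.
move=> [x y] [z rxz szy]; apply: jtrans; first exact: eqv_joinl rxz.
exact: eqv_joinr.
Qed.

End EquivalenceJoin.

Section Hyperconvexity.
Variables (E : Type) (L : set (set (E * E))).
Hypothesis L_sublattice : eqv_sublattice L.
Hypothesis L_bigcap : bigcap_closed L.

Let Leqv r : L r -> is_equivalence r.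
Proof. by case: L_sublattice => + _ _; apply. Qed.

Let LI r s : L r -> L s -> L (r `&` s).
Proof. by case: L_sublattice => _ + _; apply. Qed.

Let Ljoin r s : L r -> L s -> L (eqv_join r s).
Proof. by case: L_sublattice => _ _; apply. Qed.

Lemma dist_subE r x y : L r -> dist L x y `<=` r <-> r (x, y).
Proof.
have [_ dxy dle] := dist_least x y L_bigcap.
by move=> Lr; split=> [|rxy]; [apply|exact: dle].
Qed.

Lemma bigI_closed (I : Type) (s : seq I) (r : I -> set (E * E)) :
  (forall i, L (r i)) -> L (\big[setI/setT]_(i <- s) r i).
Proof.
move=> Lr; elim/big_rec: _ => [|i q _ Lq]; last exact: LI.
(* [setT] lies in [L] as the intersection of the empty subfamily. *)
by rewrite -(bigcap_set0 id); exact: L_bigcap.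
Qed.

(** The dual law follows by expanding twice with distributivity: each resulting term lies in [r] or
    in the meet of [s] and [t]. *)
Lemma distributive_joinI r s t : distributive_lattice L ->
  L r -> L s -> L t ->
  eqv_join r s `&` eqv_join r t `<=` eqv_join r (s `&` t).
Proof.
move=> LD Lr Ls Lt; rewrite LD ?Ljoin //; last exact: Ljoin.
have Jeqv := eqv_join_is_equivalence r (s `&` t).
apply: eqv_join_min => //.
  by move=> p [_ rp]; exact: eqv_joinl.
rewrite setIC LD //; apply: eqv_join_min => // p [].
- by move=> _ rp; exact: eqv_joinl.
- by move=> tp sp; exact: eqv_joinr.
Qed.

Lemma distributive_join_bigI (I : eqType) (s : seq I) (r : I -> set (E * E))
    q p : distributive_lattice L -> L q -> (forall i, L (r i)) ->
  (forall i, i \in s -> eqv_join q (r i) p) ->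
  eqv_join q (\big[setI/setT]_(i <- s) r i) p.
Proof.
move=> LD Lq Lr; elim: s => [|i s IHs] qr.
  by rewrite big_nil; exact: eqv_joinr.
rewrite big_cons; apply: distributive_joinI => //; first exact: bigI_closed.
split; first by apply: qr; exact: mem_head.
by apply: IHs => j js; apply: qr; rewrite inE js orbT.
Qed.

Lemma arithmetical_hyperconvex :
  arithmetical L -> finitely_hyperconvex L (dist L).
Proof.
move=> [LD LC] I a r /card_gt0P [i0 _] Lr ar.
have {}ar i j : eqv_join (r i) (r j) (a i, a j).
  by apply/dist_subE; [exact: Ljoin|exact: ar].
suff [x rx] : exists x, forall i, i \in enum I -> r i (a i, x).
  by exists x => i _; apply/dist_subE => //; apply: rx; rewrite mem_enum.
(* The index type is inhabited, so [a i0] can serve as solution of the empty system. *)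
elim: (enum I) => [|i s [x rx]]; first by exists (a i0).
set t := \big[setI/setT]_(j <- s) r j.
have Lt : L t by exact: bigI_closed.
have tE p : t p -> forall j, j \in s -> r j p.
  by rewrite /t -bigcap_seq => tp j; exact: tp.
(* Going through [a j] puts [(a i, x)] in the join of [r i] and [r j] for each [j] already
   treated. *)
have : eqv_join (r i) t (a i, x).
  apply: distributive_join_bigI => // j js.
  have [_ _ jtrans] := eqv_join_is_equivalence (r i) (r j).
  by apply: jtrans (ar i j) _; apply: eqv_joinr; exact: rx.
rewrite eqv_join_comp; [|exact: Leqv|exact: Leqv|exact: LC].
(* The new point [y] is congruent to [x] modulo [t], so it still solves the earlier congruences. *)
move=> [y /= ry ty]; exists y => j; rewrite inE => /predU1P[->//|js].
have [_ rsym rtrans] := Leqv (Lr j).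
by apply: rtrans (rx j js) _; apply: rsym; exact: tE.
Qed.

Lemma hyperconvex_three_balls r s t x y : finitely_hyperconvex L (dist L) ->
  L r -> L s -> L t -> r (x, y) -> eqv_join s t (x, y) ->
  exists w, [/\ s (x, w), t (y, w) & r (x, w)].
Proof.
move=> H Lr Ls Lt rxy stxy.
(* [None], [Some false] and [Some true] index B(x, r), B(x, s) and B(y, t). *)
pose a (i : option bool) := if i == Some true then y else x.
pose q (i : option bool) := if i is Some b then if b then t else s else r.
have Lq i : L (q i) by case: i => [[]|].
have aq i j : eqv_join (q i) (q j) (a i, a j).
  have [J1 J2 _] := eqv_join_is_equivalence (q i) (q j).
  case: i j J1 J2 => [[]|] [[]|] J1 J2; rewrite /a /=; try exact: J1.
  - by apply: J2; rewrite /= eqv_joinC.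
  - by apply: J2; exact: eqv_joinr.
  - exact: stxy.
  - exact: eqv_joinl.
have [||w Hw] := H _ a q _ Lq.
- by rewrite card_option.
- by move=> i j; apply/dist_subE; [exact: Ljoin|exact: aq].
exists w; split.
- by apply/(dist_subE _ _ Ls); exact: (Hw (Some false)).
- by apply/(dist_subE _ _ Lt); exact: (Hw (Some true)).
- by apply/(dist_subE _ _ Lr); exact: (Hw None).
Qed.

Lemma hyperconvex_arithmetical :
  finitely_hyperconvex L (dist L) -> arithmetical L.
Proof.
move=> H; split=> [r s t Lr Ls Lt|].
  have [_ rsym rtrans] := Leqv Lr; have [_ tsym _] := Leqv Lt.
  apply/seteqP; split=> [[x y] [rxy stxy]|].
    have [w [sxw tyw rxw]] := hyperconvex_three_balls H Lr Ls Lt rxy stxy.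
    have [_ _ jtrans] := eqv_join_is_equivalence (r `&` s) (r `&` t).
    apply: (jtrans _ w); first by apply: eqv_joinl.
    by apply: eqv_joinr; split; [apply: rtrans rxy; exact: rsym|exact: tsym].
  apply: eqv_join_min.
  - exact/Leqv/LI/Ljoin.
  - by apply: setIS; exact: eqv_joinl.
  - by apply: setIS; exact: eqv_joinr.
have sub r s : L r -> L s -> s \; r `<=` r \; s.
  move=> Lr Ls [x z] [y /= rxy syz].
  have [_ _ jtrans] := eqv_join_is_equivalence s r.
  have srxz : eqv_join s r (x, z).
    by apply: (jtrans _ y); [exact: eqv_joinr|exact: eqv_joinl].
  (* With the join of [s] and [r] as third radius, the third ball contains B(x, s) and adds no
     constraint. *)
  have [w [sxw rzw _]] :=
    hyperconvex_three_balls H (Ljoin Ls Lr) Ls Lr srxz srxz.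
  by exists w => //; have [_ rsym _] := Leqv Lr; exact: rsym.
by move=> r s Lr Ls; apply/seteqP; split; exact: sub.
Qed.

End Hyperconvexity.

Theorem theorem7p2 (E : Type) (L : set (set (E * E)))
    (L_sublattice : eqv_sublattice L)
    (L_diagonal : L diagonal)
    (L_bigcap : bigcap_closed L) :
  arithmetical L <-> finitely_hyperconvex L (dist L).
Proof.
split; first exact: arithmetical_hyperconvex.
exact: hyperconvex_arithmetical.
Qed.
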